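(* Let $X$ be a metric space equipped with an isometric action by a compact group $G$, and let $\psi\colon X\to H$ be a map into a Hilbert space $H$ carrying a unitary action by $G$. Suppose $\psi$ is $\gamma$-Lipschitz, orbit expanding, and alignment preserving. Let $\phi\colon X/G\to H'$ be a map into a Hilbert space $H'$ with optimal lower and upper Lipschitz bounds $\alpha_\phi,\beta_\phi\in[0,\infty]$, and define $$c:=\begin{cases}1&\text{if }G=\langle\sigma\rangle\text{ with }\sigma v=-v\text{ for }v\in H\text{ and }\dim(H)=1,\\ \sqrt2&\text{if }G=\langle\sigma\rangle\text{ with }\sigma v=-v\text{ for }v\in H\text{ and }\dim(H)>1,\\ 2&\text{otherwise.}\end{cases}$$ Then the map $\Psi\colon X\to H'\times H$ defined by $\Psi(x)=\big(\phi([x]),\ c\cdot\alpha_\phi\cdot\psi(x)\big)$ satisfies $$\kappa(\Psi)\leq\sqrt2\cdot\sqrt{\kappa(\phi)^2+(c\gamma)^2}.$$ In particular, $c_2(X)\leq\sqrt2\cdot\sqrt{c_2(X/G)^2+(c\gamma)^2}$.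
   Context: For a map $f\colon X\to Y$ of metric spaces, the optimal lower and upper Lipschitz bounds $\alpha,\beta\in[0,\infty]$ are the largest and smallest constants (respectively) with $\alpha\, d_X(x,x')\le d_Y(f(x),f(x'))\le\beta\, d_X(x,x')$ for all $x,x'\in X$; the distortion of $f$ is $\kappa(f):=\beta/\alpha$, where $\kappa(f)=\infty$ if $\alpha=0$ or $\beta=\infty$. The Euclidean distortion $c_2(X)\in[1,\infty]$ is the infimum of all $c$ for which there exist a Hilbert space $H$ and a map $f\colon X\to H$ with $\kappa(f)=c$. The orbit space $X/G$, whose points are the orbits $[x]=G\cdot x$, carries the quotient metric $d([x],[y])=\inf_{p\in[x],\,q\in[y]}d_X(p,q)$. The map $\psi\colon X\to H$ is: - orbit expanding if $\|\psi(x)-g\cdot\psi(x)\|\ge d_X(x,gx)$ for every $x\in X$ and $g\in G$; - alignment preserving if for every $x,y\in X$ there exists $g\in G$ that simultaneously minimizes $d_X(x,gy)$ and $\|\psi(x)-g\cdot\psi(y)\|$. Here $\langle\sigma\rangle$ is the group generated by $\sigma$, and $H'\times H$ carries the product Hilbert space structure. *)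

(* Defs.v *)
From HB Require Import structures.
From mathcomp Require Import ring lra.
From mathcomp Require Import all_boot all_order all_algebra.
From mathcomp Require Import all_classical all_reals all_analysis.

Set Implicit Arguments.
Unset Strict Implicit.
Unset Printing Implicit Defensive.

Import Order.TTheory GRing.Theory Num.Theory.
Import numFieldNormedType.Exports.

Local Open Scope classical_set_scope.
Local Open Scope ring_scope.

(* Real scalars: a complex Hilbert space is covered through its underlying real
   one, and [hdim] below is the real dimension.
   The [Metric] component adds no data: [mdist] is forced to be the distance
   of the norm, see [hilbert_mdistE]. *)
HB.mixin Record hasInnerProduct (R : realType) H & NormedModule R H := {
  dotp : H -> H -> R ;
  dotpC : forall u v, dotp u v = dotp v u ;
  dotpDl : forall u v w, dotp (u + v) w = dotp u w + dotp v w ;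
  dotpZl : forall (a : R) u v, dotp (a *: u) v = a * dotp u v ;
  sqr_norm_dotp : forall u, `|u| ^+ 2 = dotp u u
}.

#[short(type="hilbertType")]
HB.structure Definition Hilbert (R : realType) :=
  {H of CompleteNormedModule R H & Metric R H & hasInnerProduct R H}.

Lemma hilbert_mdistE (R : realType) (H : hilbertType R) (u v : H) :
  mdist u v = `|u - v|.
Proof.
have E d : (mdist u v < d) = (`|u - v| < d).
  have : ball u d v = ball_ (fun x : H => `|x|) u d v by rewrite ball_normE.
  rewrite ballEmdist /= => e.
  by apply/idP/idP => h; [rewrite -e | rewrite e].
by apply/eqP; rewrite eq_le !leNgt -E ltxx E ltxx.
Qed.

Section dimension.
Context {R : realType} (H : hilbertType R).

Definition lin_indep n (e : 'I_n -> H) : Prop :=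
  forall a : 'I_n -> R, \sum_i a i *: e i = 0 -> forall i, a i = 0.

(* +oo for an infinite-dimensional space, without distinguishing cardinals *)
Definition hdim : \bar R :=
  ereal_sup [set n%:R%:E | n in [set n | exists e : 'I_n -> H, lin_indep e]].

End dimension.

(* The product [V * W] of normed modules already carries the max norm, hence
   an alias. *)
Definition l2prod (V W : Type) : Type := (V * W)%type.

Section l2prod.
Context {R : realType} (V W : hilbertType R).
Local Notation P := (l2prod V W).

HB.instance Definition _ := GRing.Lmodule.copy P (V * W)%type.

Implicit Types u v w : P.

Definition l2prod_dotp u v : R := dotp u.1 v.1 + dotp u.2 v.2.
Definition l2prod_norm u : R := Num.sqrt (`|u.1| ^+ 2 + `|u.2| ^+ 2).

Let dotpDr (H : hilbertType R) (a b c : H) : dotp a (b + c) = dotp a b + dotp a c.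
Proof. by rewrite dotpC dotpDl !(dotpC a). Qed.

Let normD2 (H : hilbertType R) (a b : H) :
  `|a + b| ^+ 2 = `|a| ^+ 2 + 2 * dotp a b + `|b| ^+ 2.
Proof.
rewrite !sqr_norm_dotp dotpDl !dotpDr (dotpC b a) mulr_natl mulr2n.
by rewrite !addrA.
Qed.

Let dotp_le (H : hilbertType R) (a b : H) : dotp a b <= `|a| * `|b|.
Proof.
have : `|a + b| ^+ 2 <= (`|a| + `|b|) ^+ 2.
  by rewrite ler_sqr ?nnegrE ?addr_ge0// ler_normD.
by rewrite normD2 sqrrD mulr2n; lra.
Qed.

Let sqr_l2prod_norm u : l2prod_norm u ^+ 2 = `|u.1| ^+ 2 + `|u.2| ^+ 2.
Proof. by rewrite sqr_sqrtr// addr_ge0// sqr_ge0. Qed.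

Let l2prod_norm_ge0 u : 0 <= l2prod_norm u.
Proof. exact: sqrtr_ge0. Qed.

Let l2prod_ler_normD u v :
  l2prod_norm (u + v) <= l2prod_norm u + l2prod_norm v.
Proof.
rewrite -ler_sqr ?nnegrE ?addr_ge0// sqrrD !sqr_l2prod_norm /= !normD2.
have h : dotp u.1 v.1 + dotp u.2 v.2 <= l2prod_norm u * l2prod_norm v.
  apply: (@le_trans _ _ (`|u.1| * `|v.1| + `|u.2| * `|v.2|)).
    by apply: lerD; exact: dotp_le.
  rewrite -ler_sqr ?nnegrE ?mulr_ge0 ?addr_ge0 ?mulr_ge0//.
  rewrite exprMn !sqr_l2prod_norm -subr_ge0.
  set a := `|u.1|; set b := `|u.2|; set c := `|v.1|; set d := `|v.2|.
  have -> : (a ^+ 2 + b ^+ 2) * (c ^+ 2 + d ^+ 2) - (a * c + b * d) ^+ 2 =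
    (a * d - b * c) ^+ 2 by ring.
  exact: sqr_ge0.
by rewrite mulr2n; lra.
Qed.

Let l2prod_normrZ (a : R) u : l2prod_norm (a *: u) = `|a| * l2prod_norm u.
Proof.
rewrite /l2prod_norm /= !normrZ !exprMn -mulrDr sqrtrM ?sqr_ge0//.
by rewrite sqrtr_sqr normr_id.
Qed.

Let l2prod_normr0_eq0 u : l2prod_norm u = 0 -> u = 0.
Proof.
move=> /(congr1 (fun x => x ^+ 2)); rewrite sqr_l2prod_norm expr0n/= => /eqP.
rewrite paddr_eq0 ?sqr_ge0// !sqrf_eq0 !normr_eq0 => /andP[/eqP u1 /eqP u2].
by case: u u1 u2 => /= ? ? -> ->.
Qed.

HB.instance Definition _ := Lmodule_isNormed.Build R P
  l2prod_ler_normD l2prod_normrZ l2prod_normr0_eq0.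

Lemma l2prod_normE u : `|u| = Num.sqrt (`|u.1| ^+ 2 + `|u.2| ^+ 2).
Proof. by []. Qed.

Let normE u : `|u| = l2prod_norm u. Proof. by []. Qed.

Let norm1_le u : `|u.1| <= `|u|.
Proof.
by rewrite normE -ler_sqr ?nnegrE// sqr_l2prod_norm lerDl sqr_ge0.
Qed.

Let norm2_le u : `|u.2| <= `|u|.
Proof.
by rewrite normE -ler_sqr ?nnegrE// sqr_l2prod_norm lerDr sqr_ge0.
Qed.

Let norm_leD u : `|u| <= `|u.1| + `|u.2|.
Proof.
rewrite normE -ler_sqr ?nnegrE ?addr_ge0// sqr_l2prod_norm sqrrD.
by rewrite lerD2r lerDl mulrn_wge0// mulr_ge0.
Qed.

Let l2prod_cauchy_cvg (F : set_system P) :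
  ProperFilter F -> cauchy F -> cvg F.
Proof.
move=> PF /cauchyP Fc.
have c1 : cauchy (fst @ F).
  apply/cauchyP => _/posnumP[e]; have [x xF] := Fc e%:num (gt0 e).
  exists x.1; rewrite /nbhs /=; apply: (filterS _ xF) => y /=; rewrite -!ball_normE /= => xy.
  exact: le_lt_trans (norm1_le (x - y)) xy.
have c2 : cauchy (snd @ F).
  apply/cauchyP => _/posnumP[e]; have [x xF] := Fc e%:num (gt0 e).
  exists x.2; rewrite /nbhs /=; apply: (filterS _ xF) => y /=; rewrite -!ball_normE /= => xy.
  exact: le_lt_trans (norm2_le (x - y)) xy.
have /cvg_ex[l1 Fl1] : cvg (fst @ F) by exact/cauchy_cvgP.
have /cvg_ex[l2 Fl2] : cvg (snd @ F) by exact/cauchy_cvgP.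
apply/cvg_ex; exists ((l1, l2) : P); apply/fcvgrPdist_lt => _/posnumP[e].
have e2 : 0 < e%:num / 2 by rewrite divr_gt0.
have F1 : \forall y \near F, `|l1 - y.1| < e%:num / 2.
  by move/cvgrPdist_lt : Fl1 => /(_ _ e2).
have F2 : \forall y \near F, `|l2 - y.2| < e%:num / 2.
  by move/cvgrPdist_lt : Fl2 => /(_ _ e2).
near=> y.
rewrite (splitr e%:num) (le_lt_trans (norm_leD _))//= ltrD//.
- by near: y; exact: F1.
- by near: y; exact: F2.
Unshelve. all: by end_near. Qed.

HB.instance Definition _ := Uniform_isComplete.Build P l2prod_cauchy_cvg.

Let l2prod_mdist_eq0 u v : `|u - v| = 0 -> u = v.
Proof. by move=> /normr0_eq0/subr0_eq. Qed.

Let l2prod_ballE u (d : R) : ball u d = [set v | `|u - v| < d].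
Proof. by rewrite -ball_normE. Qed.

HB.instance Definition _ := PseudoMetric_isMetric.Build R P
  (fun u v => normr_ge0 (u - v)) l2prod_mdist_eq0 l2prod_ballE.

Let l2prod_dotpC u v : l2prod_dotp u v = l2prod_dotp v u.
Proof. by rewrite /l2prod_dotp dotpC (dotpC u.2). Qed.

Let l2prod_dotpDl u v w :
  l2prod_dotp (u + v) w = l2prod_dotp u w + l2prod_dotp v w.
Proof. by rewrite /l2prod_dotp /= !dotpDl addrACA. Qed.

Let l2prod_dotpZl (a : R) u v : l2prod_dotp (a *: u) v = a * l2prod_dotp u v.
Proof. by rewrite /l2prod_dotp /= !dotpZl mulrDr. Qed.

Let l2prod_sqr_norm u : `|u| ^+ 2 = l2prod_dotp u u.
Proof. by rewrite normE sqr_l2prod_norm !sqr_norm_dotp. Qed.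

HB.instance Definition _ := hasInnerProduct.Build R P
  l2prod_dotpC l2prod_dotpDl l2prod_dotpZl l2prod_sqr_norm.

End l2prod.

Section distortion.
Context {R : realType}.
Local Open Scope ereal_scope.

Section lipschitz_bounds.
Context {T U : metricType R} (f : T -> U).

Definition lower_lip : \bar R := ereal_sup [set a : \bar R | 0 <= a /\
  forall x y, a * (mdist x y)%:E <= (mdist (f x) (f y))%:E].

Definition upper_lip : \bar R := ereal_inf [set b : \bar R | 0 <= b /\
  forall x y, (mdist (f x) (f y))%:E <= b * (mdist x y)%:E].

Definition distortion : \bar R :=
  if (lower_lip == 0) || (upper_lip == +oo) then +oo
  else upper_lip / lower_lip.

End lipschitz_bounds.

(* If [T] has at most one point then [lower_lip f = +oo] and
   [upper_lip f = 0] for every [f], so that [distortion f = 0]; the maximum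
   with 1 only matters in that case, and ensures [1 <= euclidean_distortion]. *)
Definition euclidean_distortion (T : metricType R) : \bar R :=
  maxe 1 (ereal_inf [set c | exists (H : hilbertType R) (f : T -> H),
                       distortion f = c]).

End distortion.

HB.mixin Record isTopologicalGroup G & Topological G & Group G := {
  mulg_continuous : continuous (fun p : G * G => (p.1 * p.2)%g) ;
  invg_continuous : continuous (fun g : G => (g^-1)%g)
}.

#[short(type="topologicalGroupType")]
HB.structure Definition TopologicalGroup :=
  {G of Topological G & Group G & isTopologicalGroup G}.

HB.mixin Record isCompactGroup G & TopologicalGroup G := {
  compact_group : compact [set: G]
}.

#[short(type="compactGroupType")]
HB.structure Definition CompactGroup :=
  {G of TopologicalGroup G & isCompactGroup G}.

(* For an action by isometries, continuity of the orbit maps is equivalent to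
   joint continuity. *)
Record isometric_action (R : realType) (G : topologicalGroupType)
    (X : metricType R) := IsometricAction {
  act :> G -> X -> X ;
  act1 : forall x, act 1%g x = x ;
  actM : forall g h x, act (g * h)%g x = act g (act h x) ;
  act_isometry : forall g x y, mdist (act g x) (act g y) = mdist x y ;
  act_continuous : forall x, continuous (fun g => act g x)
}.

(* Strong continuity is not required. *)
Record unitary_action (R : realType) (G : groupType)
    (H : hilbertType R) := UnitaryAction {
  uact :> G -> H -> H ;
  uact1 : forall v, uact 1%g v = v ;
  uactM : forall g h v, uact (g * h)%g v = uact g (uact h v) ;
  uact_linear : forall g, linear (uact g) ;
  uact_dotp : forall g u v, dotp (uact g u) (uact g v) = dotp u v
}.

Section orbit_space.
Context {R : realType} {G : compactGroupType} {X : metricType R}.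
Variable A : isometric_action G X.

Definition orbit (x : X) : set X := range (fun g => A g x).

Record orbit_space := OrbitSpace {
  orbit_set : set X ;
  orbit_setP : exists x, orbit_set = orbit x
}.

Definition orbit_class (x : X) : orbit_space :=
  OrbitSpace (ex_intro _ x (erefl (orbit x))).

Definition orbit_dist (O1 O2 : orbit_space) : R :=
  inf [set mdist pq.1 pq.2 | pq in orbit_set O1 `*` orbit_set O2].

HB.instance Definition _ := gen_eqMixin orbit_space.
HB.instance Definition _ := gen_choiceMixin orbit_space.

Let orbit_space_eq (O1 O2 : orbit_space) :
  orbit_set O1 = orbit_set O2 -> O1 = O2.
Proof.
case: O1 O2 => [S1 p1] [S2 p2] /= S12; subst S2.
by rewrite (Prop_irrelevance p1 p2).
Qed.

Let dist_set (O1 O2 : orbit_space) : set R :=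
  [set mdist pq.1 pq.2 | pq in orbit_set O1 `*` orbit_set O2].

Let dist_set_lb O1 O2 : lbound (dist_set O1 O2) 0.
Proof. by move=> _ [pq _ <-]; exact: mdist_ge0. Qed.

Let orbit_refl x : orbit x x.
Proof. by exists 1%g => //; rewrite act1. Qed.

Let orbit_inh (O : orbit_space) : exists x, orbit_set O x.
Proof. by have [x ->] := orbit_setP O; exists x. Qed.

Let orbit_eq (O : orbit_space) x : orbit_set O x -> orbit_set O = orbit x.
Proof.
have [y ->] := orbit_setP O => -[g _ <-].
apply/seteqP; split => _ [h _ <-].
- exists (h * g^-1)%g => //.
  by rewrite actM -(actM A g^-1 g) mulVg act1.
- by exists (h * g)%g => //; rewrite actM.
Qed.

Let orbit_act (O : orbit_space) g x : orbit_set O x -> orbit_set O (A g x).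
Proof. by move=> /orbit_eq ->; exists g. Qed.

Let has_inf_dist O1 O2 : has_inf (dist_set O1 O2).
Proof.
split; last by exists 0; exact: dist_set_lb.
have [x ?] := orbit_inh O1; have [y ?] := orbit_inh O2.
by exists (mdist x y); exists (x, y).
Qed.

Let orbit_dist_le (O1 O2 : orbit_space) x y :
  orbit_set O1 x -> orbit_set O2 y -> orbit_dist O1 O2 <= mdist x y.
Proof.
move=> ? ?; apply: ge_inf; first by have [] := has_inf_dist O1 O2.
by exists (x, y).
Qed.

Let orbit_dist_ge0 O1 O2 : 0 <= orbit_dist O1 O2.
Proof.
by apply: lb_le_inf; [have [] := has_inf_dist O1 O2|exact: dist_set_lb].
Qed.

Let orbit_dist_lt (O1 O2 : orbit_space) x e :
  orbit_set O1 x -> orbit_dist O1 O2 < e ->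
  exists2 y, orbit_set O2 y & mdist x y < e.
Proof.
move=> O1x /(inf_lt (proj1 (has_inf_dist O1 O2)))[_ [[p q] [/= O1p O2q] <-] pqe].
move: O1x; rewrite (orbit_eq O1p) => -[g _ <-].
by exists (A g q); [exact: orbit_act|rewrite act_isometry].
Qed.

Let orbit_distxx O : orbit_dist O O = 0.
Proof.
have [x Ox] := orbit_inh O; apply/le_anti; rewrite orbit_dist_ge0 andbT.
by rewrite (le_trans (orbit_dist_le Ox Ox))// mdistxx.
Qed.

Let orbit_dist_sym O1 O2 : orbit_dist O1 O2 = orbit_dist O2 O1.
Proof.
congr inf; apply/seteqP; split => _ [[p q] [/= ? ?] <-];
  by exists (q, p) => //=; rewrite metric_sym.
Qed.

Let orbit_dist_triangle O2 O1 O3 :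
  orbit_dist O1 O3 <= orbit_dist O1 O2 + orbit_dist O2 O3.
Proof.
apply/ler_addgt0Pr => e e0.
have [x O1x] := orbit_inh O1.
have e20 : 0 < e / 2 by rewrite divr_gt0.
have [y O2y xy] :
    exists2 y, orbit_set O2 y & mdist x y < orbit_dist O1 O2 + e / 2.
  by apply: (orbit_dist_lt O1x); rewrite ltrDl.
have [z O3z yz] :
    exists2 z, orbit_set O3 z & mdist y z < orbit_dist O2 O3 + e / 2.
  by apply: (orbit_dist_lt O2y); rewrite ltrDl.
have := orbit_dist_le O1x O3z; have := metric_triangle x y z.
by move: xy yz; lra.
Qed.

Let orbit_closed x : closed (orbit x).
Proof.
apply: compact_closed; first exact: metric_hausdorff.
apply: continuous_compact; last exact: compact_group.
exact/continuous_subspaceT/act_continuous.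
Qed.

Let orbit_dist_eq0 O1 O2 : orbit_dist O1 O2 = 0 -> O1 = O2.
Proof.
move=> d0; apply: orbit_space_eq.
have [x O1x] := orbit_inh O1; have [y O2y] := orbit_inh O2.
rewrite (orbit_eq O1x); apply/esym/orbit_eq.
rewrite (orbit_eq O2y); apply: orbit_closed => B /nbhs_ballP[e /= e0 xeB].
have [z O2z xz] : exists2 z, orbit_set O2 z & mdist x z < e.
  by apply: (orbit_dist_lt O1x); rewrite d0.
exists z; split; first by rewrite -(orbit_eq O2y).
by apply: xeB; rewrite ballEmdist.
Qed.

HB.instance Definition _ := isMetric.Build R orbit_space
  orbit_distxx orbit_dist_eq0 orbit_dist_sym orbit_dist_triangle.

End orbit_space.

Section conditions.
Context {R : realType} {G : compactGroupType} {X : metricType R}.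
Context {H : hilbertType R}.
Variables (A : isometric_action G X) (U : unitary_action G H) (psi : X -> H).

Definition orbit_expanding : Prop :=
  forall x g, mdist x (A g x) <= `|psi x - U g (psi x)|.

Definition alignment_preserving : Prop :=
  forall x y, exists g,
    (forall h, mdist x (A g y) <= mdist x (A h y)) /\
    (forall h, `|psi x - U g (psi y)| <= `|psi x - U h (psi y)|).

End conditions.

Section align_const.
Context {R : realType} {G : groupType} {H : hilbertType R}.

Definition generated_by (s : G) : Prop :=
  forall g : G, exists n : nat, g = (s ^+ n)%g \/ g = (s ^- n)%g.

Definition generated_by_negation (U : unitary_action G H) : Prop :=
  exists s : G, generated_by s /\ forall v, U s v = - v.

Definition align_const (U : unitary_action G H) : R :=
  if `[< generated_by_negation U /\ hdim H = 1%:E >] then 1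
  else if `[< generated_by_negation U /\ (1%:E < hdim H)%E >] then Num.sqrt 2
  else 2.

End align_const.

(* Main.v *)
(* Let g align y with x, so that d(x, gy) = d([x], [y]). Orbit expansion bounds the
   detour from y to gy by |psi y - g psi y|, which is at most 2 |psi x - psi y|
   since |psi x - g psi y| <= |psi x - psi y|. Hence
     d(x, y) <= d([x], [y]) + c |psi x - psi y|
   with c = 2. If G acts by signs and g acts as -1, then <psi x, psi y> <= 0, and
   the shorter of the detours y -> gy and x -> g^-1 x costs
   2 min(|psi x|, |psi y|), which is at most sqrt 2 |psi x - psi y|, and at most
   |psi x - psi y| on a line. The square of the displayed inequality gives the
   lower Lipschitz bound alpha / sqrt 2 for Psi; the upper one is immediate. *)

Require Import Defs.
From HB Require Import structures.
From mathcomp Require Import all_boot all_order all_algebra.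
From mathcomp Require Import all_classical all_reals all_analysis.
From mathcomp Require Import ring lra.

Set Implicit Arguments.
Unset Strict Implicit.
Unset Printing Implicit Defensive.

Import Order.TTheory GRing.Theory Num.Theory.
Import numFieldNormedType.Exports.

Local Open Scope classical_set_scope.
Local Open Scope ring_scope.

(** * Inner products: lines and obtuse angles *)

Section inner_product.
Context {R : realType} (H : hilbertType R).
Implicit Types u v w : H.

Lemma dotpNl u v : dotp (- u) v = - dotp u v.
Proof. by rewrite -scaleN1r dotpZl mulN1r. Qed.

Lemma dotp0l v : dotp 0 v = 0.
Proof. by rewrite -(scale0r 0) dotpZl mul0r. Qed.

Lemma dotpDr u v w : dotp u (v + w) = dotp u v + dotp u w.
Proof. by rewrite dotpC dotpDl !(dotpC u). Qed.

Lemma sqr_normD u v : `|u + v| ^+ 2 = `|u| ^+ 2 + `|v| ^+ 2 + 2 * dotp u v.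
Proof.
by rewrite !sqr_norm_dotp dotpDl !dotpDr (dotpC v u); ring.
Qed.

Lemma sqr_normB u v : `|u - v| ^+ 2 = `|u| ^+ 2 + `|v| ^+ 2 - 2 * dotp u v.
Proof. by rewrite sqr_normD normrN dotpC dotpNl dotpC mulrN. Qed.

Lemma dotp_le0 u v : `|u + v| <= `|u - v| -> dotp u v <= 0.
Proof. by rewrite -ler_sqr ?nnegrE// sqr_normD sqr_normB; lra. Qed.

(** Equality in Cauchy-Schwarz: a nonzero component of [v] orthogonal to [u] would give two
    independent vectors. *)
Lemma sqr_dotp_hdim1 u v : hdim H = 1%:E -> dotp u v ^+ 2 = `|u| ^+ 2 * `|v| ^+ 2.
Proof.
move=> dimH; have [->|u0] := eqVneq u 0; first by rewrite dotp0l normr0 !expr0n mul0r.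
(* The component of [v] orthogonal to [u], scaled by [|u|^2] to avoid a division. *)
pose w := `|u| ^+ 2 *: v - dotp u v *: u.
have uw : dotp w u = 0.
  by rewrite /w -scaleNr dotpDl !dotpZl -sqr_norm_dotp (dotpC v); ring.
suff w0 : w = 0.
  have : dotp w v = 0 by rewrite w0 dotp0l.
  by rewrite /w -scaleNr dotpDl !dotpZl -sqr_norm_dotp; lra.
apply/eqP/negP => /negP w0.
suff : (2%:R%:E <= hdim H)%E by rewrite dimH lee_fin; lra.
apply: ereal_sup_ubound; exists 2 => //; exists (fun i => if i == ord0 then u else w).
move=> a; rewrite !big_ord_recl big_ord0 addr0 /= => auw.
have dot_eq0 (z : H) (b : R) : z != 0 -> b * dotp z z = 0 -> b = 0.
  move=> z0 /eqP; rewrite mulf_eq0 -sqr_norm_dotp sqrf_eq0 normr_eq0 (negPf z0) orbF.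
  by move/eqP.
have a0 : a ord0 = 0.
  apply: (dot_eq0 u _ u0) => //; have := congr1 (fun z => dotp z u) auw.
  by rewrite dotpDl !dotpZl uw dotp0l mulr0 addr0.
have a1 : a (lift ord0 ord0) = 0.
  apply: (dot_eq0 w _ w0) => //; have := congr1 (fun z => dotp z w) auw.
  by rewrite a0 scale0r add0r dotpZl dotp0l.
case=> -[|[|//]] i; first by rewrite -[RHS]a0; congr a; exact: val_inj.
by rewrite -[RHS]a1; congr a; exact: val_inj.
Qed.

(** For an obtuse angle, [|u - v|^2] is at least [|u|^2 + |v|^2], hence at least twice the square of
    the minimum. *)
Lemma normB_obtuse u v : dotp u v <= 0 ->
  2 * Num.min `|u| `|v| <= Num.sqrt 2 * `|u - v|.
Proof.
move=> uv; rewrite -ler_sqr ?nnegrE ?mulr_ge0 ?sqrtr_ge0 ?le_min ?normr_ge0//.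
rewrite !exprMn sqr_sqrtr// sqr_normB.
have := sqr_ge0 (`|u|); have := sqr_ge0 (`|v|).
have : Num.min `|u| `|v| ^+ 2 <= `|u| ^+ 2.
  by rewrite ler_sqr ?nnegrE ?le_min ?normr_ge0// ge_min lexx.
have : Num.min `|u| `|v| ^+ 2 <= `|v| ^+ 2.
  by rewrite ler_sqr ?nnegrE ?le_min ?normr_ge0// ge_min lexx orbT.
by lra.
Qed.

(** On a line an obtuse pair points in opposite directions, so [|u - v| = |u| + |v|]. *)
Lemma normB_obtuse_hdim1 u v : hdim H = 1%:E -> dotp u v <= 0 ->
  2 * Num.min `|u| `|v| <= `|u - v|.
Proof.
move=> dimH uv.
have uvE : - dotp u v = `|u| * `|v|.
  apply/eqP; rewrite -(@eqrXn2 _ 2)// ?oppr_ge0 ?mulr_ge0//.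
  by rewrite sqrrN exprMn sqr_dotp_hdim1.
have -> : `|u - v| = `|u| + `|v|.
  by apply/eqP; rewrite -(@eqrXn2 _ 2)// ?addr_ge0// sqr_normB; apply/eqP; lra.
have : Num.min `|u| `|v| <= `|u| by rewrite ge_min lexx.
have : Num.min `|u| `|v| <= `|v| by rewrite ge_min lexx orbT.
by lra.
Qed.

End inner_product.

(** * Optimal Lipschitz bounds and distortion *)

Section lipschitz.
Context {R : realType} {T V : metricType R} (f : T -> V).

Lemma lower_lip_ge0 : (0 <= lower_lip f)%E.
Proof.
by apply: ereal_sup_ubound; split => // x y; rewrite mul0e lee_fin mdist_ge0.
Qed.

Lemma upper_lip_ge0 : (0 <= upper_lip f)%E.
Proof. by apply/ereal_infP => b []. Qed.

Lemma lower_lip_le x y : (lower_lip f * (mdist x y)%:E <= (mdist (f x) (f y))%:E)%E.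
Proof.
(* At distance 0 the convention [+oo * 0 = 0] covers an infinite bound. *)
have [->|xy] := eqVneq (mdist x y) 0; first by rewrite mule0 lee_fin mdist_ge0.
have d0 : 0 < mdist x y by rewrite lt_neqAle eq_sym xy mdist_ge0.
rewrite -lee_pdivlMr//; apply/ereal_supP => a [_ /(_ x y)].
by rewrite lee_pdivlMr.
Qed.

Lemma upper_lip_le (b : R) : upper_lip f = b%:E ->
  forall x y, mdist (f x) (f y) <= b * mdist x y.
Proof.
move=> fb x y; apply/ler_addgt0Pr => e e0.
(* The infimum is approached within [e / (d + 1)], where [d] is the distance; the [+ 1] allows
   [d = 0], and the total error is at most [e]. *)
have d1 : 0 < mdist x y + 1 by rewrite ltr_wpDl ?mdist_ge0.
have : (upper_lip f < (b + e / (mdist x y + 1))%:E)%E.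
  by rewrite fb lte_fin ltrDl divr_gt0.
move=> /ereal_inf_lt[[r| |] [//= r0 /(_ x y)]]; rewrite -?EFinM ?lee_fin ?lte_fin// => fr rb.
apply: (le_trans fr); apply: (@le_trans _ _ ((b + e / (mdist x y + 1)) * mdist x y)).
  by rewrite ler_wpM2r ?mdist_ge0// ltW.
rewrite mulrDl lerD2l mulrAC ler_pdivrMr// ler_wpM2l ?ltW//.
by rewrite ltrDl.
Qed.

Lemma distortion_le (a b : R) : 0 < a -> 0 <= b ->
  (forall x y, a * mdist x y <= mdist (f x) (f y)) ->
  (forall x y, mdist (f x) (f y) <= b * mdist x y) ->
  (distortion f <= (b / a)%:E)%E.
Proof.
move=> a0 b0 fa fb.
have la : (a%:E <= lower_lip f)%E.
  apply: ereal_sup_ubound; split; first by rewrite lee_fin ltW.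
  by move=> x y; rewrite -EFinM lee_fin.
have ub : (upper_lip f <= b%:E)%E.
  apply: ereal_inf_lbound; split; first by rewrite lee_fin.
  by move=> x y; rewrite -EFinM lee_fin.
rewrite /distortion; move: la ub upper_lip_ge0.
case: (lower_lip f) => [l| |]//; case: (upper_lip f) => [u| |]//=.
  rewrite !lee_fin orbF eqe => al ub u0; have l0 := lt_le_trans a0 al.
  by rewrite inver gt_eqF// -EFinM lee_fin ler_pM// ?invr_ge0 ?lef_pV2// ltW.
(* Here [lower_lip f = +oo], and the quotient is 0. *)
by move=> _ _ _; rewrite invey mule0 lee_fin divr_ge0// ltW.
Qed.

Lemma distortion_ge0 : (0 <= distortion f)%E.
Proof.
rewrite /distortion; case: ifP => // _.
by rewrite mule_ge0 ?inve_ge0 ?upper_lip_ge0 ?lower_lip_ge0.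
Qed.

Lemma distortion_fin (a b : R) : 0 < a ->
  lower_lip f = a%:E -> upper_lip f = b%:E -> distortion f = (b / a)%:E.
Proof.
move=> a0 fa fb; rewrite /distortion fa fb eqe gt_eqF//=.
by rewrite inver gt_eqF// -EFinM.
Qed.

End lipschitz.

(** * Orbit distance, alignment and detours *)

Section orbit_alignment.
Context {R : realType} {G : compactGroupType} {X : metricType R}.
Context {H : hilbertType R}.
Variables (A : isometric_action G X) (U : unitary_action G H) (psi : X -> H).

Lemma mdist_orbit_class_le x y :
  mdist (orbit_class A x) (orbit_class A y) <= mdist x y.
Proof.
apply: ge_inf; first by exists 0 => _ [pq _ <-]; exact: mdist_ge0.
by exists (x, y) => //; split; exists 1%g; rewrite ?act1.
Qed.

(** Since [d(gx, hy) = d(x, g^-1 h y)], the infimum over both orbits may be taken by moving [y]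
    alone. *)
Lemma mdist_orbit_class_ge x y m :
  (forall g, m <= mdist x (A g y)) ->
  m <= mdist (orbit_class A x) (orbit_class A y).
Proof.
move=> xym; apply: lb_le_inf.
  by exists (mdist x y), (x, y) => //; split; exists 1%g; rewrite ?act1.
move=> _ [[p q] [/= [g _ <-] [h _ <-]] <-].
apply: (le_trans (xym (g^-1 * h)%g)).
by rewrite -(act_isometry A g) -actM mulgA mulgV mul1g.
Qed.

Lemma uactK g v : U g^-1%g (U g v) = v.
Proof. by rewrite -uactM mulVg uact1. Qed.

Lemma generated_by_negation_sign : generated_by_negation U ->
  forall g, (forall v, U g v = v) \/ (forall v, U g v = - v).
Proof.
move=> [s [sG sN]].
have uactV g : (forall v, U g v = v) \/ (forall v, U g v = - v) ->
    (forall v, U g^-1%g v = v) \/ (forall v, U g^-1%g v = - v).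
  case=> gE; [left|right] => v; first by rewrite -{1}(gE v) uactK.
  by rewrite -{1}[v]opprK -(gE (- v)) uactK.
have sX n : (forall v, U (s ^+ n)%g v = v) \/ (forall v, U (s ^+ n)%g v = - v).
  elim: n => [|n [sn|sn]]; first by left=> v; rewrite expg0 uact1.
    by right=> v; rewrite expgS uactM sn sN.
  by left=> v; rewrite expgS uactM sn sN opprK.
by move=> g; have [n [->|->]] := sG g; [|apply: uactV].
Qed.

Lemma align_const_ge1 : 1 <= align_const U.
Proof.
rewrite /align_const; case: ifP => // _; case: ifP => // _; last lra.
by rewrite -[leLHS]sqrtr1 ler_sqrt//; lra.
Qed.

Hypothesis psi_expanding : orbit_expanding A U psi.
Hypothesis psi_alignment : alignment_preserving A U psi.

(** Comparing the aligning [g] with the identity gives the first bound. The last two pass through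
    [gy] and [g^-1 x], using [d(g^-1 x, y) = d(x, gy)]. *)
Lemma alignment_detour x y : exists g,
  [/\ `|psi x - U g (psi y)| <= `|psi x - psi y|,
      mdist x y <= mdist (orbit_class A x) (orbit_class A y)
                   + `|psi y - U g (psi y)| &
      mdist x y <= mdist (orbit_class A x) (orbit_class A y)
                   + `|psi x - U g^-1%g (psi x)|].
Proof.
have [g [gX gH]] := psi_alignment x y; exists g.
have gxy := mdist_orbit_class_ge gX.
split; first by rewrite -{2}[psi y](uact1 U).
  apply: (le_trans (metric_triangle x (A g y) y)); apply: lerD => //.
  by rewrite metric_sym.
apply: (le_trans (metric_triangle x (A g^-1%g x) y)); rewrite addrC; apply: lerD => //.
by rewrite -(act_isometry A g) -actM mulgV act1.
Qed.

Lemma mdist_le_orbit x y :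
  mdist x y <= mdist (orbit_class A x) (orbit_class A y)
               + align_const U * `|psi x - psi y|.
Proof.
have [g [gle yle xle]] := alignment_detour x y.
have sgn : generated_by_negation U ->
    (mdist x y <= mdist (orbit_class A x) (orbit_class A y)) \/
    (dotp (psi x) (psi y) <= 0 /\
     mdist x y <= mdist (orbit_class A x) (orbit_class A y)
                  + 2 * Num.min `|psi x| `|psi y|).
  move=> /generated_by_negation_sign /(_ g)[gE|gE].
    (* If [g] acts trivially on [H], the detour costs nothing. *)
    by left; move: yle; rewrite gE subrr normr0 addr0.
  have gVE v : U g^-1%g v = - v by rewrite -{1}[v]opprK -(gE (- v)) uactK.
  (* If [g] acts as -1, [gle] reads [|psi x + psi y| <= |psi x - psi y|], an obtuse angle, and the
     detours cost [2 |psi y|] and [2 |psi x|]. *)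
  right; split; first by apply: dotp_le0; move: gle; rewrite gE opprK.
  move: yle xle; rewrite gE gVE !opprK -!mulr2n !normrMn !mulr2n.
  by rewrite minEle; case: ifP; lra.
have c0 : 0 <= align_const U * `|psi x - psi y|.
  by rewrite mulr_ge0// (le_trans _ align_const_ge1).
rewrite /align_const in c0 *; case: ifPn c0 => [/asboolP[negU dimH]|_] c0.
  have [?|[uv xy]] := sgn negU; first by lra.
  by have := normB_obtuse_hdim1 dimH uv; lra.
case: ifPn c0 => [/asboolP[negU dimH]|_] c0.
  have [?|[uv xy]] := sgn negU; first by lra.
  by have := normB_obtuse uv; lra.
(* The constant 2 works for every action: triangle inequality through [psi x], then [gle]. *)
have := ler_distD (psi x) (psi y) (U g (psi y)); rewrite (distrC (psi y) (psi x)).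
by move: gle yle; lra.
Qed.

End orbit_alignment.

(** * Distortion of the combined map and Euclidean distortion *)

Section distortion_bounds.
Context {R : realType} {G : compactGroupType} {X : metricType R}.
Context {H : hilbertType R}.
Variables (A : isometric_action G X) (U : unitary_action G H) (psi : X -> H).
Variable gamma : R.
Hypothesis gamma_ge0 : 0 <= gamma.
Hypothesis psi_lipschitz : forall x y, `|psi x - psi y| <= gamma * mdist x y.
Hypothesis psi_expanding : orbit_expanding A U psi.
Hypothesis psi_alignment : alignment_preserving A U psi.

Let c := align_const U.

Lemma distortion_orbit_pair (H' : hilbertType R) (phi : orbit_space A -> H')
    (a : R) : lower_lip phi = a%:E ->
  (distortion
     (fun x => (phi (orbit_class A x), (c * a) *: psi x) : l2prod H' H)
    <= (Num.sqrt 2)%:E * sqrte (distortion phi ^+ 2 + ((c * gamma) ^+ 2)%:E))%E.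
Proof.
move=> phia; set Psi : X -> l2prod H' H := fun x => _.
have s2_gt0 : 0 < Num.sqrt 2 :> R by rewrite sqrtr_gt0.
(* Disposes of the degenerate cases [a = 0] and [upper_lip phi = +oo]. *)
have inftyE : distortion phi = +oo%E ->
    ((Num.sqrt 2)%:E * sqrte (distortion phi ^+ 2 + ((c * gamma) ^+ 2)%:E) = +oo)%E.
  by move=> ->; rewrite expe2 mulyy /= gt0_muley ?lte_fin.
have a_ge0 : 0 <= a by rewrite -lee_fin -phia lower_lip_ge0.
have [a0|a_neq0] := eqVneq a 0.
  by rewrite inftyE ?leey// /distortion phia a0 eqxx.
have a_gt0 : 0 < a by rewrite lt_neqAle eq_sym a_neq0.
have := upper_lip_ge0 phi; case phib : (upper_lip phi) => [b| |]// b_ge0; last first.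
  by rewrite inftyE ?leey// /distortion phib eqxx orbT.
rewrite lee_fin in b_ge0.
have c_ge0 : 0 <= c by apply: le_trans (align_const_ge1 U).
have PsiE x y : mdist (Psi x) (Psi y) ^+ 2 =
    mdist (phi (orbit_class A x)) (phi (orbit_class A y)) ^+ 2
    + (c * a * `|psi x - psi y|) ^+ 2.
  rewrite !hilbert_mdistE l2prod_normE sqr_sqrtr ?addr_ge0 ?sqr_ge0//=.
  by rewrite -scalerBr normrZ ger0_norm ?mulr_ge0.
rewrite (distortion_fin a_gt0 phia phib) -EFin_expe -EFinD /= -EFinM.
(* [Psi] has upper bound [sqrt L] and lower bound [a / sqrt 2]; their quotient is the claimed
   value. *)
pose L := b ^+ 2 + (c * a * gamma) ^+ 2.
have -> : Num.sqrt 2 * Num.sqrt ((b / a) ^+ 2 + (c * gamma) ^+ 2)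
    = Num.sqrt L / (a / Num.sqrt 2).
  have -> : L = a ^+ 2 * ((b / a) ^+ 2 + (c * gamma) ^+ 2) by rewrite /L; field.
  by rewrite sqrtrM ?sqr_ge0// sqrtr_sqr ger0_norm//; field; rewrite a_neq0 gt_eqF.
apply: distortion_le; rewrite ?divr_gt0 ?sqrtr_ge0// => x y.
- rewrite -ler_sqr ?nnegrE ?mulr_ge0 ?divr_ge0 ?mdist_ge0 ?sqrtr_ge0// PsiE.
  rewrite !exprMn exprVn sqr_sqrtr//.
  set p := mdist (phi _) _; set q := `|_|.
  have pge : a * mdist (orbit_class A x) (orbit_class A y) <= p.
    by rewrite -lee_fin EFinM -phia lower_lip_le.
  have p_ge0 : 0 <= p by exact: mdist_ge0.
  have q_ge0 : 0 <= q by exact: normr_ge0.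
  have adp : a * mdist x y <= p + c * a * q.
    rewrite [c * a]mulrC -mulrA; apply: le_trans (lerD pge (lexx _)).
    by rewrite -mulrDr ler_wpM2l// mdist_le_orbit.
  have : (a * mdist x y) ^+ 2 <= (p + c * a * q) ^+ 2.
    by rewrite ler_sqr ?nnegrE ?addr_ge0 ?mulr_ge0 ?mdist_ge0.
  (* Gives [(p + c a q)^2 <= 2 (p^2 + (c a q)^2)], the source of the factor [sqrt 2]. *)
  have := sqr_ge0 (p - c * a * q).
  by rewrite sqrrB sqrrD !exprMn; lra.
- rewrite -ler_sqr ?nnegrE ?mulr_ge0 ?mdist_ge0 ?sqrtr_ge0// PsiE.
  rewrite [leRHS]exprMn sqr_sqrtr ?addr_ge0 ?sqr_ge0// mulrDl -!exprMn; apply: lerD.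
    rewrite ler_sqr ?nnegrE ?mulr_ge0 ?mdist_ge0//.
    apply: le_trans (upper_lip_le phib _ _) _.
    by rewrite ler_wpM2l// mdist_orbit_class_le.
  rewrite ler_sqr ?nnegrE ?mulr_ge0 ?mdist_ge0// -[leRHS]mulrA.
  by rewrite ler_wpM2l ?mulr_ge0.
Qed.

(** With the orbit term zero, [mdist_le_orbit] makes [1 / c] a lower Lipschitz bound for [psi]. This
    serves the case of a one-point orbit space. *)
Lemma distortion_transitive :
  (forall x y, mdist (orbit_class A x) (orbit_class A y) = 0) ->
  (distortion psi <= (c * gamma)%:E)%E.
Proof.
move=> d0; have c_gt0 : 0 < c by apply: lt_le_trans (align_const_ge1 U).
rewrite mulrC -[c]invrK; apply: distortion_le; rewrite ?invr_gt0// => x y.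
  rewrite ler_pdivrMl// hilbert_mdistE.
  by have := mdist_le_orbit psi_expanding psi_alignment x y; rewrite d0 add0r.
by rewrite hilbert_mdistE.
Qed.

(** The infimum over [phi] need not be attained, so near-optimal maps are used with a slack [e]. *)
Lemma euclidean_distortion_orbit :
  (euclidean_distortion X <= (Num.sqrt 2)%:E *
     sqrte (euclidean_distortion (orbit_space A) ^+ 2
            + ((c * gamma) ^+ 2)%:E))%E.
Proof.
set K := euclidean_distortion (orbit_space A).
have s2_gt0 : 0 < Num.sqrt 2 :> R by rewrite sqrtr_gt0.
have K1 : (1 <= K)%E by rewrite le_max lexx.
have infK : (ereal_inf [set d | exists (H' : hilbertType R)
    (f : orbit_space A -> H'), distortion f = d] <= K)%E.
  by rewrite le_max lexx orbT.
case: K K1 infK => [k| |]// k1 infK; last first.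
  by rewrite expe2 mulyy /= gt0_muley ?lte_fin// leey.
rewrite lee_fin in k1.
have k0 : 0 <= k by apply: le_trans k1.
have s0 : 0 <= c * gamma.
  by rewrite mulr_ge0// (le_trans _ (align_const_ge1 U)).
rewrite -EFin_expe -EFinD /= -EFinM; set s := c * gamma in s0 *.
set r := Num.sqrt 2 * _.
have r0 : 0 <= r by rewrite mulr_ge0 ?sqrtr_ge0.
have r2 : r ^+ 2 = 2 * (k ^+ 2 + s ^+ 2).
  by rewrite exprMn !sqr_sqrtr ?addr_ge0 ?sqr_ge0.
have rM t : 0 <= t -> (t <= r) = (t ^+ 2 <= 2 * (k ^+ 2 + s ^+ 2)).
  by move=> t0; rewrite -r2 ler_sqr ?nnegrE.
have k2 : 1 <= k ^+ 2 by rewrite -[leLHS](expr1n _ 2) ler_sqr ?nnegrE.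
(* The maximum with 1 in the definition is harmless: [k >= 1] forces [r >= 1]. *)
rewrite ge_max lee_fin rM// expr1n; apply/andP; split.
  by have := sqr_ge0 s; lra.
apply/lee_addgt0Pr => e e0.
(* The slack [e / sqrt 2] becomes [e] after multiplication by [sqrt 2]. *)
have e20 : 0 < e / Num.sqrt 2 by rewrite divr_gt0.
have : (ereal_inf [set d | exists (H' : hilbertType R)
    (f : orbit_space A -> H'), distortion f = d] < (k + e / Num.sqrt 2)%:E)%E.
  by apply: le_lt_trans infK _; rewrite lte_fin ltrDl.
move=> /ereal_inf_lt[_ [H' [phi <-]] phik].
(* If [lower_lip phi = +oo] then [X/G] has at most one point, and [psi] itself
   embeds [X] with distortion at most [c * gamma]. *)
have := lower_lip_ge0 phi; case phia : (lower_lip phi) => [a| |]// _; last first.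
  have dist0 (u v : orbit_space A) : mdist u v = 0.
    have := mdist_ge0 u v; rewrite le_eqVlt => /predU1P[<-//|d0].
    by have := lower_lip_le phi u v; rewrite phia gt0_mulye ?lte_fin.
  apply: (@le_trans _ _ s%:E).
    apply: le_trans (distortion_transitive _); last by move=> x y; exact: dist0.
    by apply: ereal_inf_lbound; exists H, psi.
  rewrite lee_fin -[leLHS]addr0 lerD ?(ltW e0)// rM//.
  by have := sqr_ge0 s; lra.
apply: le_trans (le_trans (distortion_orbit_pair phia) _).
  apply: ereal_inf_lbound; exists (l2prod H' H : hilbertType R).
  by exists (fun x => (phi (orbit_class A x), (c * a) *: psi x)).
have := distortion_ge0 phi; move: phik.
case: (distortion phi) => [l| |]//; rewrite lte_fin lee_fin => lk l0.
rewrite -EFin_expe -EFinD /= -EFinM lee_fin -/s.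
have -> : r + e = Num.sqrt 2 * (Num.sqrt (k ^+ 2 + s ^+ 2) + e / Num.sqrt 2).
  by rewrite /r; field; rewrite gt_eqF.
(* Raising [k] by [f] raises [w = sqrt (k^2 + s^2)] by at most [f]: since [k <= w], [(k + f)^2 + s^2
   = w^2 + 2 k f + f^2 <= (w + f)^2]. *)
rewrite ler_pM2l//; set f := e / _ in e20 lk *.
set w := Num.sqrt (k ^+ 2 + _).
have w0 : 0 <= w by exact: sqrtr_ge0.
have w2 : w ^+ 2 = k ^+ 2 + s ^+ 2 by rewrite sqr_sqrtr// addr_ge0 ?sqr_ge0.
have kw : k <= w by rewrite -ler_sqr ?nnegrE// w2 lerDl sqr_ge0.
rewrite -ler_sqr ?nnegrE ?sqrtr_ge0 ?addr_ge0 ?(ltW e20)//.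
rewrite sqr_sqrtr ?addr_ge0 ?sqr_ge0//.
have : l ^+ 2 <= (k + f) ^+ 2 by rewrite ler_sqr ?nnegrE ?addr_ge0 ?(ltW e20)// ltW.
have : k * f <= w * f by rewrite ler_wpM2r// ltW.
by rewrite !sqrrD w2 !mulr2n; lra.
Qed.

End distortion_bounds.

Theorem theorem11 (R : realType) (G : compactGroupType) (X : metricType R)
    (A : isometric_action G X) (H : hilbertType R) (U : unitary_action G H)
    (psi : X -> H) (gamma : R) (gamma_ge0 : 0 <= gamma)
    (psi_lipschitz : forall x y, `|psi x - psi y| <= gamma * mdist x y)
    (psi_expanding : orbit_expanding A U psi)
    (psi_alignment : alignment_preserving A U psi) :
  let c : R := align_const U in
  (forall (H' : hilbertType R) (phi : orbit_space A -> H') (alpha_phi : R),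
    lower_lip phi = alpha_phi%:E ->
    let Psi : X -> l2prod H' H :=
      fun x => (phi (orbit_class A x), (c * alpha_phi) *: psi x) in
    (distortion Psi <= (Num.sqrt 2)%:E *
       sqrte (distortion phi ^+ 2 + ((c * gamma) ^+ 2)%:E))%E) /\
  (euclidean_distortion X <= (Num.sqrt 2)%:E *
     sqrte (euclidean_distortion (orbit_space A) ^+ 2
            + ((c * gamma) ^+ 2)%:E))%E.
Proof.
move=> c; split; last exact: euclidean_distortion_orbit.
by move=> H' phi a phia; exact: distortion_orbit_pair.
Qed.
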